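(* Let $p$ be an odd prime. Then $$\sum_{k=0}^{\frac{p-1}{2}}(4k+1)\binom{-\frac12}{k}^5 \equiv -\frac{p}{\Gamma_p\left(\frac34\right)^4} \pmod{p^3}\quad\text{if } p\equiv 1 \pmod 4,$$ and $$\sum_{k=0}^{\frac{p-1}{2}}(4k+1)\binom{-\frac12}{k}^5 \equiv 0 \pmod{p^3}\quad\text{if } p\equiv 3 \pmod 4,$$ where $\Gamma_p$ is the $p$-adic Gamma function.
   Context: For a non-negative integer $k$, $\binom{x}{k}=\frac{x(x-1)\cdots(x-k+1)}{k!}$ is the generalized binomial coefficient (so $\binom{-1/2}{k}\in\mathbb{Z}_p\cap\mathbb{Q}$ for odd $p$). Congruences modulo $p^3$ are taken in the ring $\mathbb{Z}_p$ of $p$-adic integers. The $p$-adic Gamma function is defined for positive integers $n$ by $\Gamma_p(n):=(-1)^n\prod_{j}j$, the product running over integers $1\le j<n$ with $p\nmid j$; it is extended to all $x\in\mathbb{Z}_p$ by $\Gamma_p(x):=\lim_{n\to x}\Gamma_p(n)$, where $n$ runs through any sequence of positive integers $p$-adically approaching $x$, and $\Gamma_p(0):=1$. The limit exists, is independent of the sequence chosen, and defines a continuous function on $\mathbb{Z}_p$. *)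

(* Defs.v *)
From HB Require Import structures.
From mathcomp Require Import all_boot all_order all_algebra.
From mathcomp Require Import boolp classical_sets functions topology.

Set Implicit Arguments.
Unset Strict Implicit.
Unset Printing Implicit Defensive.

Import Order.TTheory GRing.Theory.
Local Open Scope classical_set_scope.
Local Open Scope ring_scope.

Definition congr_mod (R : nzRingType) (m x y : R) : Prop :=
  exists c : R, x - y = m * c.

(* The ring Z_p as the inverse limit of the rings Z/p^n.  [pres x n] is the
   residue of [x] modulo p^n, represented in [0, p^n) (the coherence condition
   forces this range).  The primality proof is a parameter of the type so that
   Z_p is nontrivial and its units are the elements with nonzero residue
   modulo p. *)
Record padic_int (p : nat) (p_pr : prime p) := PadicInt {
  pres :> nat -> nat;
  presP : forall n, pres n = (pres n.+1 %% p ^ n)%N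
}.

Notation "''Zp[' p_pr ]" := (padic_int p_pr)
  (at level 8, format "''Zp[' p_pr ]") : type_scope.

Section PadicRing.
Variables (p : nat) (p_pr : prime p).
Local Notation Zp := (padic_int p_pr).
Implicit Types x y z : Zp.

HB.instance Definition _ := gen_eqMixin Zp.
HB.instance Definition _ := gen_choiceMixin Zp.

Lemma padic_eqP x y : (forall n, x n = y n) -> x = y.
Proof.
case: x y => [f fP] [g gP] /= fg.
have {}fg : f = g by apply: funext.
by case: g / fg gP => gP; congr PadicInt; exact: Prop_irrelevance.
Qed.

Lemma presK x n : (x n %% p ^ n)%N = x n.
Proof. by rewrite presP modn_mod. Qed.

Lemma modn_expS m n : (m %% p ^ n.+1 = m %[mod p ^ n])%N.
Proof. by rewrite modn_dvdm // expnS dvdn_mull. Qed.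

Lemma padic_subproof (f : nat -> nat) :
  (forall n, f n = f n.+1 %[mod p ^ n])%N ->
  forall n, (f n %% p ^ n)%N = ((f n.+1 %% p ^ n.+1) %% p ^ n)%N.
Proof. by move=> fP n; rewrite modn_expS. Qed.

Definition mkpadic f fP : Zp := PadicInt p_pr (@padic_subproof f fP).

Lemma padic_const_subproof m n : (m = m %[mod p ^ n])%N.
Proof. by []. Qed.

Definition padic0 := mkpadic (padic_const_subproof 0).
Definition padic1 := mkpadic (padic_const_subproof 1).

Lemma padic_opp_subproof x n :
  (p ^ n - x n = p ^ n.+1 - x n.+1 %[mod p ^ n])%N.
Proof.
have lex m : (x m <= p ^ m)%N.
  by rewrite -presK ltnW // ltn_pmod // expn_gt0 prime_gt0.
apply/eqP; rewrite -(eqn_modDr (x n.+1)) subnK //.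
rewrite -modnDmr -presP subnK // modnn; apply/eqP/esym/eqP.
by rewrite -/(dvdn _ _) expnS dvdn_mull.
Qed.
Definition padic_opp x := mkpadic (padic_opp_subproof x).

Lemma padic_add_subproof x y n :
  (x n + y n = x n.+1 + y n.+1 %[mod p ^ n])%N.
Proof. by rewrite (presP x) (presP y) modnDm. Qed.
Definition padic_add x y := mkpadic (padic_add_subproof x y).

Lemma padic_mul_subproof x y n :
  (x n * y n = x n.+1 * y n.+1 %[mod p ^ n])%N.
Proof. by rewrite (presP x) (presP y) modnMm. Qed.
Definition padic_mul x y := mkpadic (padic_mul_subproof x y).

Lemma padic_addA : associative padic_add.
Proof.
by move=> x y z; apply: padic_eqP => n /=; rewrite modnDml modnDmr addnA.
Qed.

Lemma padic_addC : commutative padic_add.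
Proof. by move=> x y; apply: padic_eqP => n /=; rewrite addnC. Qed.

Lemma padic_add0 : left_id padic0 padic_add.
Proof.
by move=> x; apply: padic_eqP => n /=; rewrite modnDml add0n presK.
Qed.

Lemma padic_addN : left_inverse padic0 padic_opp padic_add.
Proof.
move=> x; apply: padic_eqP => n /=; rewrite modnDml subnK ?modnn ?mod0n //.
by rewrite -presK ltnW // ltn_pmod // expn_gt0 prime_gt0.
Qed.

HB.instance Definition _ := GRing.isZmodule.Build Zp
  padic_addA padic_addC padic_add0 padic_addN.

Lemma padic_mulA : associative padic_mul.
Proof.
by move=> x y z; apply: padic_eqP => n /=; rewrite modnMml modnMmr mulnA.
Qed.

Lemma padic_mulC : commutative padic_mul.
Proof. by move=> x y; apply: padic_eqP => n /=; rewrite mulnC. Qed.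

Lemma padic_mul1 : left_id padic1 padic_mul.
Proof.
by move=> x; apply: padic_eqP => n /=; rewrite modnMml mul1n presK.
Qed.

Lemma padic_mulDl : left_distributive padic_mul padic_add.
Proof.
move=> x y z; apply: padic_eqP => n /=.
by rewrite modnMml modnDml modnDmr mulnDl.
Qed.

Lemma padic_oner_neq0 : padic1 != padic0.
Proof.
apply/eqP => /(congr1 (fun x : Zp => x 1%N)) /=.
by rewrite expn1 modn_small ?prime_gt1 // mod0n.
Qed.

HB.instance Definition _ := GRing.Zmodule_isComNzRing.Build Zp
  padic_mulA padic_mulC padic_mul1 padic_mulDl padic_oner_neq0.

Definition padic_unit : {pred Zp} := fun x => x 1%N != 0%N.

Lemma pres1 x n : x n.+1 = x 1%N %[mod p].
Proof.
elim: n => // n <-; rewrite [x n.+1]presP modn_dvdm //.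
by rewrite expnS dvdn_mulr.
Qed.

Lemma padic_unit_coprime x n : x \in padic_unit -> coprime (p ^ n) (x n).
Proof.
case: n => [|n] ux; first exact: coprime1n.
rewrite coprimeXl // prime_coprime // /dvdn pres1 -{2}[p]expn1 presK.
exact: ux.
Qed.

Definition padic_inv_res x n := (egcdn (x n) (p ^ n)).1.

Lemma padic_inv_resP x n : x \in padic_unit ->
  (padic_inv_res x n * x n = 1 %[mod p ^ n])%N.
Proof.
move=> /(padic_unit_coprime n) co_x; rewrite /padic_inv_res.
have [x0|x_gt0] := posnP (x n).
  by move: co_x; rewrite x0 /coprime gcdn0 => /eqP ->; rewrite !modn1.
case: egcdnP => // km kn -> _ /=.
by move: co_x; rewrite coprime_sym => /eqP ->; rewrite modnMDl.
Qed.

Lemma padic_inv_subproof x : x \in padic_unit ->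
  forall n, (padic_inv_res x n = padic_inv_res x n.+1 %[mod p ^ n])%N.
Proof.
move=> ux n; set a := padic_inv_res x n; set b := padic_inv_res x n.+1.
have ax : (a * x n = 1 %[mod p ^ n])%N by exact: padic_inv_resP.
have bx : (b * x n = 1 %[mod p ^ n])%N.
  rewrite [x n]presP modnMmr -modn_expS.
  by rewrite (padic_inv_resP n.+1 ux) modn_expS.
transitivity ((a * (b * x n)) %% p ^ n)%N.
  by rewrite -modnMmr bx modnMmr muln1.
by rewrite mulnCA -modnMmr ax modnMmr muln1.
Qed.

Definition padic_inv x :=
  if pselect (x \in padic_unit) is left ux
  then mkpadic (padic_inv_subproof ux) else x.

Lemma padic_mulVx : {in padic_unit, left_inverse 1 padic_inv *%R}.
Proof.
move=> x ux; rewrite /padic_inv; case: pselect => // ux'.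
by apply: padic_eqP => n /=; rewrite modnMml padic_inv_resP.
Qed.

Lemma padic_unitPl x y : y * x = 1 -> x \in padic_unit.
Proof.
move=> /(congr1 (fun x : Zp => x 1%N)) /= yx; apply/negP => /eqP x0.
by move: yx; rewrite x0 muln0 expn1 mod0n modn_small ?prime_gt1.
Qed.

Lemma padic_inv_out : {in [predC padic_unit], padic_inv =1 id}.
Proof. by move=> x /negP ux; rewrite /padic_inv; case: pselect. Qed.

HB.instance Definition _ := GRing.ComNzRing_hasMulInverse.Build Zp
  padic_mulVx padic_unitPl padic_inv_out.

(* The p-adic topology: the cosets x + p^n Z_p form a base of neighborhoods
   of x. *)
Definition padic_nbhs x (A : set Zp) : Prop :=
  exists n : nat, forall y, congr_mod (p%:R ^+ n) y x -> A y.

HB.instance Definition _ := hasNbhs.Build Zp padic_nbhs.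
HB.instance Definition _ := isPointed.Build Zp 0.

Lemma congr_mod_refl (m x : Zp) : congr_mod m x x.
Proof. by exists 0; rewrite subrr mulr0. Qed.

Lemma congr_mod_trans (m x y z : Zp) :
  congr_mod m x y -> congr_mod m y z -> congr_mod m x z.
Proof.
move=> [c xy] [d yz]; exists (c + d).
by rewrite mulrDr -xy -yz addrA subrK.
Qed.

Lemma congr_mod_exp k n x y : (k <= n)%N ->
  congr_mod (p%:R ^+ n) x y -> congr_mod (p%:R ^+ k) x y.
Proof.
move=> kn [c xy]; exists (p%:R ^+ (n - k) * c).
by rewrite mulrA -exprD subnKC.
Qed.

Lemma padic_nbhs_filter x : ProperFilter (nbhs x).
Proof.
split; first by case=> n /(_ x); apply; exact: congr_mod_refl.
split=> [|A B [m mA] [n nB]|A B AB [n nA]].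
- by exists 0%N.
- exists (maxn m n) => y yx; split.
    by apply: mA; apply: congr_mod_exp yx; exact: leq_maxl.
  by apply: nB; apply: congr_mod_exp yx; exact: leq_maxr.
- by exists n => y /nA /AB.
Qed.

Lemma padic_nbhs_singleton x (A : set Zp) : nbhs x A -> A x.
Proof. by case=> n; apply; exact: congr_mod_refl. Qed.

Lemma padic_nbhs_nbhs x (A : set Zp) : nbhs x A -> nbhs x (nbhs^~ A).
Proof.
case=> n nA; exists n => y yx; exists n => z zy.
by apply: nA; exact: congr_mod_trans zy yx.
Qed.

HB.instance Definition _ := Nbhs_isNbhsTopological.Build Zp
  padic_nbhs_filter padic_nbhs_singleton padic_nbhs_nbhs.

(* Only used at positive n. *)
Definition padic_gamma_nat (n : nat) : Zp :=
  (-1) ^+ n * (\prod_(1 <= j < n | ~~ (p %| j)%N) j)%:R.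

(* The limit of [padic_gamma_nat] along an arbitrary sequence of positive
   integers tending to x; [get] selects the common limit.  At a positive
   integer n the constant sequence shows that the value is
   [padic_gamma_nat n]. *)
Definition padic_gamma (x : Zp) : Zp :=
  if x == 0 then 1 else
  get [set y : Zp | forall u : nat -> nat, (forall i, 0 < u i)%N ->
    (u i)%:R @[i --> \oo] --> x -> padic_gamma_nat (u i) @[i --> \oo] --> y].

End PadicRing.

Definition gbinom (F : fieldType) (x : F) (k : nat) : F :=
  (\prod_(i < k) (x - i%:R)) / (k`!)%:R.

(* Main.v *)
(* By Saalschuetz's theorem and a telescoping sum, Whipple's transformation
   [sum_k (4k+1) (-1)^k (1/2)_k/k! R_k(x) R_k(y) =
    (-1)^n (2n+1) sum_j (1/2)_j/j! prod_(i<j) ((i+1/2)^2-x) / ((i+1)^2-y)]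
   holds for [x = (n+1/2)^2], where
   [R_k(x) = prod_(i<k) ((i+1/2)^2-x) / ((i+1)^2-x)].
   Take [2n+1 = p], so that [x = p^2/4], and [y = -x]: since
   [(a-x)(a+x) = a^2-x^2] with [x^2] divisible by p^4, the left side is the sum
   of the theorem modulo p^3, while the right side carries the factor p and is
   [(-1)^n p L_n] modulo p^3 with [L_n = sum_j (1/2)_j (-n)_j (n+1)_j / j!^3].
   The recurrence [(n+2)^2 L_(n+2) = (n+1)^2 L_n] gives [L_n = 0] for odd n and
   [L_(2m) = ((1/2)_m/m!)^2].  Finally, for [p = 4m+1], 3/4 is congruent to
   [mp+m+1] modulo p^2, and [L_(2m) Gamma_p(3/4)^4 = -1] modulo p^2 follows from
   Wilson's theorem modulo p^2 after cutting the factorial into blocks of length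
   p. *)
From HB Require Import structures.
Require Import Defs.
From mathcomp Require Import all_boot all_order all_algebra.
From mathcomp Require Import boolp classical_sets functions topology.
From mathcomp Require Import ring zify.
Import Order.TTheory GRing.Theory Num.Theory.
Local Open Scope classical_set_scope.
Local Open Scope ring_scope.

Set Implicit Arguments.
Unset Strict Implicit.
Unset Printing Implicit Defensive.

(** * Whipple's transformation and the Legendre sum *)

Section Poch.
Variable F : numFieldType.
Implicit Types (a x y : F) (i j k n : nat).

Definition poch a k := \prod_(i < k) (a + i%:R).

Lemma poch0 a : poch a 0 = 1. Proof. exact: big_ord0. Qed.
Lemma pochS a k : poch a k.+1 = poch a k * (a + k%:R).
Proof. exact: big_ord_recr. Qed.

Lemma poch_shift a k : poch a k * (a + k%:R) = a * poch (a + 1) k.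
Proof.
by rewrite -pochS /poch big_ord_recl addr0; congr (_ * _);
  apply: eq_bigr => i _; rewrite /= /bump /= natrD addrA.
Qed.

Lemma poch_rev a k : poch (1 - a - k%:R) k = (-1) ^+ k * poch a k.
Proof.
rewrite /poch (reindex_inj rev_ord_inj) /=.
transitivity (\prod_(i < k) - (a + i%:R)); last by rewrite prodrN card_ord.
by apply: eq_bigr => i _ /=; rewrite natrB // -[i.+1%:R]natr1; ring.
Qed.

Lemma poch1 k : poch 1 k = k`!%:R.
Proof.
elim: k => [|k IH]; first by rewrite poch0.
by rewrite pochS IH factS natrM mulrC nat1r.
Qed.

(** For $x = z^2$ this is $(1-z)_k(1+z)_k$, and [hsqfact x k] is $(1/2-z)_k(1/2+z)_k$. Parametrizing
    by the square lets $x$ be replaced by $-x$ without leaving the field. *)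
Definition sqfact x k := \prod_(i < k) (i.+1%:R ^+ 2 - x).
Definition hsqfact x k := \prod_(i < k) ((i%:R + 2^-1) ^+ 2 - x).

Lemma sqfactS x k : sqfact x k.+1 = sqfact x k * (k.+1%:R ^+ 2 - x).
Proof. exact: big_ord_recr. Qed.
Lemma hsqfactS x k :
  hsqfact x k.+1 = hsqfact x k * ((k%:R + 2^-1) ^+ 2 - x).
Proof. exact: big_ord_recr. Qed.

Lemma sqfact_neq0 x :
  (forall i, i.+1%:R ^+ 2 - x != 0) -> forall k, sqfact x k != 0.
Proof. by move=> hx k; apply/prodf_neq0 => i _. Qed.

(* [(-k)_j (k+1/2)_j] *)
Definition halfpoch k j : F :=
  \prod_(i < j) ((i%:R - k%:R) * (i%:R + k%:R + 2^-1)).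

Lemma halfpochS k j :
  halfpoch k j.+1 = halfpoch k j * ((j%:R - k%:R) * (j%:R + k%:R + 2^-1)).
Proof. exact: big_ord_recr. Qed.

Lemma halfpoch_small k j : (k < j)%N -> halfpoch k j = 0.
Proof.
by move=> kj; rewrite /halfpoch (bigD1 (Ordinal kj)) //= subrr !mul0r.
Qed.

Lemma natr_half_neq0 k : (k%:R + 2^-1 : F) != 0.
Proof. by rewrite lt0r_neq0 // ltr_wpDl ?ler0n // invr_gt0 ltr0n. Qed.

(** The ratio of the two products telescopes in [j]. It is kept free of denominators because $k+1-j$
    vanishes at $j = k+1$. *)
Lemma halfpoch_step k j : halfpoch k j * (k%:R + 1) * (k%:R + 2^-1 + j%:R) =
  halfpoch k.+1 j * (k%:R + 1 - j%:R) * (k%:R + 2^-1).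
Proof.
elim: j => [|j IH]; first by rewrite /halfpoch !big_ord0; ring.
rewrite !halfpochS -?[k.+1%:R]natr1 -?[j.+1%:R]natr1.
transitivity ((halfpoch k j * (k%:R + 1) * (k%:R + 2^-1 + j%:R)) *
  ((j%:R - k%:R) * (k%:R + 2^-1 + (j%:R + 1)))); first by ring.
by rewrite IH; ring.
Qed.

(** The summand of ${}_3F_2(-k, k+1/2, 1/2; 1-z, 1+z; 1)$ with $y = z^2$, a balanced series. *)
Definition saal_term y k j :=
  halfpoch k j * poch 2^-1 j / (j`!%:R * sqfact y j).

Lemma fact_natr_neq0 k : (k`!%:R : F) != 0.
Proof. by rewrite pnatr_eq0 -lt0n fact_gt0. Qed.

Lemma saal_termS y k j : (forall i, i.+1%:R ^+ 2 - y != 0) ->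
  saal_term y k j.+1 * ((j%:R + 1) * ((j%:R + 1) ^+ 2 - y)) =
  saal_term y k j *
   ((j%:R - k%:R) * (j%:R + k%:R + 2^-1) * (j%:R + 2^-1)).
Proof.
move=> hy; have := hy j; have := sqfact_neq0 hy j.
rewrite /saal_term halfpochS pochS factS natrM sqfactS -[j.+1%:R]natr1 => h1 h2.
have h3 := fact_natr_neq0 j.
have h4 : (j%:R + 1 : F) != 0 by rewrite natr1 pnatr_eq0.
by field; rewrite h1 h2 h3 h4.
Qed.

(** Creative telescoping gives the sum a first-order recurrence in [k], which the product on the
    right also satisfies. *)
Lemma saalschutz y k : (forall i, i.+1%:R ^+ 2 - y != 0) ->
  \sum_(0 <= j < k.+1) saal_term y k j = hsqfact y k / sqfact y k.
Proof.
move=> hy; elim: k => [|k IH].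
  rewrite big_nat1 /saal_term /halfpoch /poch /hsqfact /sqfact !big_ord0.
  by rewrite !mul1r.
set h := (k%:R + 2^-1 : F).
have h0 : h != 0 by exact: natr_half_neq0.
have k0 : (k%:R + 1 : F) != 0 by rewrite natr1 pnatr_eq0.
have hy' := hy k; rewrite -[k.+1%:R]natr1 in hy'.
(* Zeilberger certificate of the recurrence in k *)
pose G j := - (2 * k%:R + 3 / 2) / (k%:R + 1) * j%:R * (j%:R ^+ 2 - y)
   / (h + j%:R) * saal_term y k.+1 j.
suff key j : ((k%:R + 1) ^+ 2 - y) * saal_term y k.+1 j -
    (h ^+ 2 - y) * saal_term y k j = G j.+1 - G j.
  (* The telescoped sum is 0: [G] vanishes at 0 by its factor [j], and at [k.+2] because [halfpoch]
     does. *)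
  have : \sum_(0 <= j < k.+2) (((k%:R + 1) ^+ 2 - y) * saal_term y k.+1 j -
    (h ^+ 2 - y) * saal_term y k j) = 0.
    under eq_bigr do rewrite key.
    rewrite telescope_sumr // /G /saal_term halfpoch_small //.
    by rewrite !(mul0r, mulr0) subrr.
  have ez : saal_term y k k.+1 = 0.
    by rewrite /saal_term halfpoch_small // !mul0r.
  rewrite sumrB -!mulr_sumr.
  rewrite [X in _ - _ * X]big_nat_recr //= ez addr0 IH => /eqP.
  rewrite subr_eq0 => /eqP E.
  rewrite hsqfactS sqfactS -[k.+1%:R]natr1.
  apply: (mulfI hy'); rewrite E -/h.
  have := sqfact_neq0 hy k => hs.
  by field; rewrite hy' hs.
have hj : h + j%:R != 0 by rewrite /h addrAC -natrD natr_half_neq0.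
(* [e1] and [e2] write every term as a rational multiple of [saal_term y k.+1 j], so that [key]
   becomes an identity of rational functions. *)
have e1 : saal_term y k j = saal_term y k.+1 j * (k%:R + 1 - j%:R) * h
    / ((k%:R + 1) * (h + j%:R)).
  apply: (mulIf (mulf_neq0 k0 hj)); rewrite divfK ?mulf_neq0 //.
  have := halfpoch_step k j; rewrite -/h => E.
  rewrite /saal_term; set q := (_ / _).
  transitivity ((halfpoch k j * (k%:R + 1) * (h + j%:R)) *
     (poch 2^-1 j / (j`!%:R * sqfact y j))).
    by rewrite /q; ring.
  by rewrite E; ring.
have e2 : saal_term y k.+1 j.+1 = saal_term y k.+1 j *
   ((j%:R - (k%:R + 1)) * (j%:R + k%:R + 1 + 2^-1) * (j%:R + 2^-1))
   / ((j%:R + 1) * ((j%:R + 1) ^+ 2 - y)).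
  have j0 : (j%:R + 1 : F) != 0 by rewrite natr1 pnatr_eq0.
  have jy := hy j; rewrite -[j.+1%:R]natr1 in jy.
  apply: (mulIf (mulf_neq0 j0 jy)); rewrite divfK ?mulf_neq0 //.
  by rewrite saal_termS // -[k.+1%:R]natr1 addrA.
rewrite /G e1 e2 -[j.+1%:R]natr1.
have hj1 : h + (j%:R + 1) != 0.
  by rewrite /h addrAC natr1 -natrD natr_half_neq0.
have j0 : (j%:R + 1 : F) != 0 by rewrite natr1 pnatr_eq0.
have jy := hy j; rewrite -[j.+1%:R]natr1 in jy.
move: (saal_term _ _ _) => A.
rewrite /h in hj hj1 *.
have c i : k%:R * 2 + 1 + i%:R * 2 != 0 :> F.
  by rewrite -!natrM natr1 -natrD pnatr_eq0.
have c1 := c j.+1; rewrite -[j.+1%:R]natr1 in c1.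
by field; rewrite c k0 jy j0 c1.
Qed.

(** * Whipple's transformation *)

Definition wcoef x k : F :=
  (-1) ^+ k * poch 2^-1 k / k`!%:R * (hsqfact x k / sqfact x k).

Lemma wcoefS x k : (forall i, i.+1%:R ^+ 2 - x != 0) ->
  wcoef x k.+1 = - (wcoef x k * ((k%:R + 2^-1) * ((k%:R + 2^-1) ^+ 2 - x)))
    / ((k%:R + 1) * ((k%:R + 1) ^+ 2 - x)).
Proof.
move=> hx; have := hx k; have := sqfact_neq0 hx k.
rewrite /wcoef pochS (exprS (-1)) factS natrM hsqfactS sqfactS -[k.+1%:R]natr1.
move: (poch _ _) (hsqfact _ _) (_ ^+ k) => P H s h1 h2.
have h3 := fact_natr_neq0 k.
have h4 : (k%:R + 1 : F) != 0 by rewrite natr1 pnatr_eq0.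
by field; rewrite h1 h2 h3 h4.
Qed.

(** Up to a factor depending on [j] and [y] only, this is the inner sum left after expanding
    $R_k(y)$ by Saalschuetz and exchanging the summations. *)
Definition wsum x n j :=
  \sum_(0 <= k < n.+1) (4 * k + 1)%:R * wcoef x k * halfpoch k j.

(* The difference of the two sides is Gosper-summable in k, with antiderivative
   [G]; [x = (n+1/2)^2] makes the upper boundary term vanish. *)
Lemma wsumS n x j : x = (n%:R + 2^-1) ^+ 2 ->
    (forall i, i.+1%:R ^+ 2 - x != 0) ->
  wsum x n j.+1 = ((j%:R + 2^-1) ^+ 2 - x) * wsum x n j.
Proof.
move=> xE hx.
pose G k := 2 * wcoef x k * halfpoch k j * (k%:R - j%:R) * (k%:R ^+ 2 - x).
apply/eqP; rewrite -subr_eq0 /wsum mulr_sumr -sumrB.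
have key k : (4 * k + 1)%:R * wcoef x k * halfpoch k j.+1 -
  ((j%:R + 2^-1) ^+ 2 - x) * ((4 * k + 1)%:R * wcoef x k * halfpoch k j) =
  G k.+1 - G k.
  have k0 : (k%:R + 1 : F) != 0 by rewrite natr1 pnatr_eq0.
  have kx := hx k; rewrite -[k.+1%:R]natr1 in kx.
  rewrite /G wcoefS // -[k.+1%:R]natr1.
  set W := wcoef x k; set V := halfpoch k.+1 j.
  (* This regrouping exposes the right-hand side of [halfpoch_step], which brings [halfpoch k.+1 j]
     back to [halfpoch k j]. *)
  have -> : 2 * (- (W * ((k%:R + 2^-1) * ((k%:R + 2^-1) ^+ 2 - x)))
     / ((k%:R + 1) * ((k%:R + 1) ^+ 2 - x))) * V * (k%:R + 1 - j%:R) *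
     ((k%:R + 1) ^+ 2 - x) =
    - 2 * W * (V * (k%:R + 1 - j%:R) * (k%:R + 2^-1)) *
      ((k%:R + 2^-1) ^+ 2 - x) / (k%:R + 1) by field; rewrite k0 kx.
  by rewrite /V -halfpoch_step halfpochS natrD natrM; field.
under eq_bigr do rewrite key.
rewrite telescope_sumr // subr_eq0; apply/eqP; rewrite /G.
rewrite /wcoef hsqfactS -xE subrr !(mul0r, mulr0) /=.
(* The lower boundary term [G 0] vanishes by the factor $k - j$ if $j = 0$, and by [halfpoch 0 j]
   otherwise. *)
case: j {key G} => [|j]; first by rewrite subrr !(mul0r, mulr0).
by rewrite halfpoch_small // !(mul0r, mulr0).
Qed.

(** At $j = n$ the factor [halfpoch k n] kills every $k < n$, so a single product remains to be
    simplified. *)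
Lemma wsum_diag n x : x = (n%:R + 2^-1) ^+ 2 ->
    (forall i, i.+1%:R ^+ 2 - x != 0) ->
  wsum x n n = (-1) ^+ n * (2 * n + 1)%:R * hsqfact x n.
Proof.
move=> xE hx; rewrite /wsum big_nat_recr //= big_nat big1 ?add0r; last first.
  by move=> k /andP[_ kn]; rewrite halfpoch_small ?mulr0.
have e1 : halfpoch n n = (-1) ^+ n * n`!%:R * poch (n%:R + 2^-1) n.
  rewrite -poch1 -poch_rev /halfpoch big_split; congr (_ * _).
    by apply: eq_bigr => i _; ring.
  by apply: eq_bigr => i _; ring.
(* Each factor splits as $(i+1/2-n)(i+n+3/2)$; read backwards, the first ones give $(1/2)_n$ up to
   sign. *)
have e2 : sqfact x n = (-1) ^+ n * poch 2^-1 n * poch (n%:R + 2^-1 + 1) n.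
  rewrite -poch_rev -big_split; apply: eq_bigr => i _.
  by rewrite xE -[i.+1%:R]natr1 /=; field.
have e3 := poch_shift (n%:R + 2^-1) n.
have n20 := natr_half_neq0 (2 * n).
have x0 := sqfact_neq0 hx n; rewrite e2 in x0.
have f0 := fact_natr_neq0 n.
have := x0; rewrite !mulf_eq0 !negb_or => /andP[/andP[s0 p0] q0].
have e4 : poch (n%:R + 2^-1) n = (n%:R + 2^-1) * poch (n%:R + 2^-1 + 1) n
   / ((2 * n)%:R + 2^-1).
  by apply: (mulIf n20); rewrite divfK // -e3 natrM; ring.
rewrite /wcoef e1 e2 e4 !(natrD, natrM).
rewrite natrM in n20.
move: (poch _ n) p0 => P p0; move: (poch _ n) q0 => Q q0.
have c : 2 * n%:R * 2 + 1 != 0 :> F by rewrite -!natrM natr1 pnatr_eq0.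
by field; rewrite q0 c p0 s0 f0.
Qed.

(** The recurrence reduces everything to $j = 0$. That value is recovered from the diagonal $j = n$,
    since [hsqfact x n] has the nonzero factors $(i-n)(i+n+1)$, $i < n$. *)
Lemma wsumE n x j : x = (n%:R + 2^-1) ^+ 2 ->
    (forall i, i.+1%:R ^+ 2 - x != 0) ->
  wsum x n j = (-1) ^+ n * (2 * n + 1)%:R * hsqfact x j.
Proof.
move=> xE hx.
have E i : wsum x n i = wsum x n 0 * hsqfact x i.
  elim: i => [|i IH]; first by rewrite /hsqfact big_ord0 mulr1.
  by rewrite (wsumS _ xE hx) IH hsqfactS; ring.
rewrite E; congr (_ * _).
have h0 : hsqfact x n != 0.
  apply/prodf_neq0 => i _; rewrite xE.
  have -> : (i%:R + 2^-1) ^+ 2 - (n%:R + 2^-1) ^+ 2 =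
    (i%:R - n%:R) * (i%:R + n%:R + 1) :> F by field.
  rewrite mulf_neq0 //; last by rewrite -natrD natr1 pnatr_eq0.
  by rewrite subr_eq0 eqr_nat neq_ltn ltn_ord.
by apply: (mulIf h0); rewrite -E (wsum_diag xE hx).
Qed.

Lemma whipple n x y : x = (n%:R + 2^-1) ^+ 2 ->
    (forall i, i.+1%:R ^+ 2 - x != 0) -> (forall i, i.+1%:R ^+ 2 - y != 0) ->
  \sum_(0 <= k < n.+1) (4 * k + 1)%:R * wcoef x k * (hsqfact y k / sqfact y k) =
  (-1) ^+ n * (2 * n + 1)%:R *
  \sum_(0 <= j < n.+1) poch 2^-1 j * hsqfact x j / (j`!%:R * sqfact y j).
Proof.
move=> xE hx hy.
transitivity (\sum_(0 <= k < n.+1) \sum_(0 <= j < n.+1)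
   (4 * k + 1)%:R * wcoef x k * saal_term y k j).
  (* The Saalschuetz sum over $j \le k$ is extended to $j \le n$ by zero terms, which makes the
     double sum rectangular. *)
  rewrite !big_nat; apply: eq_bigr => k /= kn.
  rewrite -saalschutz // mulr_sumr [RHS](big_cat_nat _ kn) //=.
  rewrite [X in _ = _ + X]big_nat [X in _ = _ + X]big1 ?addr0 //.
  by move=> j /andP[kj _]; rewrite /saal_term halfpoch_small // !(mul0r, mulr0).
rewrite exchange_big mulr_sumr /=; apply: eq_bigr => j _.
transitivity (wsum x n j * (poch 2^-1 j / (j`!%:R * sqfact y j))).
  by rewrite mulr_suml; apply: eq_bigr => k _; rewrite /saal_term; ring.
by rewrite (wsumE _ xE hx); ring.
Qed.

(** * The Legendre sum and its recurrence *)

Lemma natrSS n : n.+2%:R = n%:R + 2 :> F.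
Proof. by rewrite -natrD addn2. Qed.

(* With [x = (n+1/2)^2], [hsqfact x j] is [(-n)_j (n+1)_j]. *)
Definition legendre_term n j : F :=
  poch 2^-1 j * hsqfact ((n%:R + 2^-1) ^+ 2) j / (j`!%:R * j`!%:R ^+ 2).

(** This is ${}_3F_2(-n, n+1, 1/2; 1, 1; 1)$, the mean over $\theta$ of the Legendre polynomial
    $P_n(\cos\theta)$. *)
Definition legendre_sum n := \sum_(0 <= j < n.+1) legendre_term n j.

Lemma legendre_term_small n j : (n < j)%N -> legendre_term n j = 0.
Proof.
move=> nj; rewrite /legendre_term /hsqfact (bigD1 (Ordinal nj)) //= subrr.
by rewrite !(mul0r, mulr0).
Qed.

Lemma legendre_termS n j : legendre_term n j.+1 = legendre_term n j *
  ((j%:R + 2^-1) * (j%:R - n%:R) * (j%:R + n%:R + 1)) / (j%:R + 1) ^+ 3.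
Proof.
have f0 := fact_natr_neq0 j.
have j0 : (j%:R + 1 : F) != 0 by rewrite natr1 pnatr_eq0.
rewrite /legendre_term pochS hsqfactS factS natrM -[j.+1%:R]natr1.
by field; rewrite f0 j0.
Qed.

Lemma legendre_term_shift n j :
  legendre_term n j * ((n%:R + 1 + j%:R) * (n%:R + 2 + j%:R)) =
  legendre_term n.+2 j * ((n%:R + 1 - j%:R) * (n%:R + 2 - j%:R)).
Proof.
elim: j => [|j IH].
  by rewrite /legendre_term /poch /hsqfact !big_ord0; ring.
have j0 : (j%:R + 1 : F) != 0 by rewrite natr1 pnatr_eq0.
rewrite !legendre_termS -[j.+1%:R]natr1 natrSS.
transitivity (legendre_term n j * ((n%:R + 1 + j%:R) * (n%:R + 2 + j%:R)) *
  ((j%:R + 2^-1) * (j%:R - n%:R) * (j%:R + n%:R + 3)) / (j%:R + 1) ^+ 3).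
  by field.
by rewrite IH; field.
Qed.

Lemma legendre_sumSS n :
  (n%:R + 2) ^+ 2 * legendre_sum n.+2 = (n%:R + 1) ^+ 2 * legendre_sum n.
Proof.
(* Zeilberger certificate of the recurrence *)
pose G j := - 2 * (2 * n%:R + 3) * j%:R ^+ 3 * legendre_term n.+2 j /
  ((n%:R + 1 + j%:R) * (n%:R + 2 + j%:R)).
have key j : (n%:R + 2) ^+ 2 * legendre_term n.+2 j -
  (n%:R + 1) ^+ 2 * legendre_term n j = G j.+1 - G j.
  have d1 i : (n%:R + 1 + i%:R : F) != 0 by rewrite natr1 -natrD pnatr_eq0.
  have d2 i : (n%:R + 2 + i%:R : F) != 0.
    by rewrite -natrD -natrD pnatr_eq0 addn2.
  have c1 := d1 j; have c2 := d2 j; have c3 := d1 j.+1; have c4 := d2 j.+1.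
  rewrite -[j.+1%:R]natr1 in c3 c4.
  have j0 : (j%:R + 1 : F) != 0 by rewrite natr1 pnatr_eq0.
  have -> : legendre_term n j = legendre_term n.+2 j *
     ((n%:R + 1 - j%:R) * (n%:R + 2 - j%:R)) /
     ((n%:R + 1 + j%:R) * (n%:R + 2 + j%:R)).
    by rewrite -legendre_term_shift mulfK // mulf_neq0.
  rewrite /G legendre_termS -[j.+1%:R]natr1 natrSS.
  by field; rewrite c1 c2 c4 j0.
have := telescope_sumr G (leq0n n.+3).
under eq_bigr do rewrite -key.
rewrite sumrB -!mulr_sumr /G legendre_term_small // expr0n.
rewrite !(mul0r, mulr0) subrr.
have -> : \sum_(0 <= j < n.+3) legendre_term n j = legendre_sum n.
  by rewrite 2?big_nat_recr //= !legendre_term_small ?addr0.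
by move=> /eqP; rewrite subr_eq0 => /eqP.
Qed.

(** The recurrence in steps of two propagates $L_1 = 1 - 1 = 0$. *)
Lemma legendre_sum_odd m : legendre_sum m.*2.+1 = 0.
Proof.
elim: m => [|m IH].
  rewrite /legendre_sum big_nat_recr //= big_nat1 /legendre_term.
  rewrite /poch /hsqfact !big_ord_recr !big_ord0 /=.
  by rewrite double0 factS fact0; field.
have c : (m.*2.+1%:R + 2 : F) ^+ 2 != 0.
  by rewrite expf_neq0 // -natrD pnatr_eq0 addn2.
by apply: (mulfI c); rewrite doubleS legendre_sumSS IH !mulr0.
Qed.

Lemma legendre_sum_even m : legendre_sum m.*2 = (poch 2^-1 m / m`!%:R) ^+ 2.
Proof.
elim: m => [|m IH].
  rewrite /legendre_sum big_nat1 /legendre_term.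
  by rewrite /poch /hsqfact !big_ord0 fact0; field.
have c : (m.*2%:R + 2 : F) ^+ 2 != 0.
  by rewrite expf_neq0 // -natrD pnatr_eq0 addn2.
have f0 := fact_natr_neq0 m.
have m0 : (m%:R + 1 : F) != 0 by rewrite natr1 pnatr_eq0.
apply: (mulfI c); rewrite doubleS legendre_sumSS IH.
rewrite pochS factS natrM -[m.+1%:R]natr1 -mul2n natrM.
by field; rewrite f0 m0.
Qed.
End Poch.

(** * Rationals integral at p *)

Section Local.
Variables (p : nat) (p_pr : prime p).
Implicit Types (x y z : rat) (k : nat).

(* The primality proof is an argument only to make the subring structure
   canonical. *)
Definition pint of prime p : {pred rat} := fun x => ~~ (p %| `|denq x|)%N.
Local Notation Zloc := (pint p_pr).

(** The fraction need not be reduced, so closure under the ring operations follows by multiplying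
    denominators. *)
Lemma pintP x : reflect
  (exists2 d : nat, ~~ (p %| d)%N & exists a : int, x * d%:R = a%:~R)
  (x \in Zloc).
Proof.
apply: (iffP idP) => [px|[d pd [a E]]].
  exists `|denq x|%N; first exact: px.
  exists (numq x); rewrite natr_absz gtr0_norm ?denq_gt0 //.
  by rewrite -{1}(divq_num_den x) divfK // intr_eq0 denq_neq0.
apply: contra pd => pd; apply: dvdn_trans pd _.
have E2 : numq x * d%:Z = a * denq x.
  apply: (@intr_inj rat); rewrite !rmorphM /= -E mulrAC; congr (_ * _).
  by rewrite -{2}(divq_num_den x) divfK // intr_eq0 denq_neq0.
rewrite -(@Gauss_dvdr _ `|numq x|%N); last first.
  by rewrite coprime_sym coprime_num_den.
by have /(congr1 absz) := E2; rewrite !abszM /= => ->; rewrite dvdn_mull.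
Qed.

Fact pint_subring : subring_closed Zloc.
Proof.
split.
- apply/pintP; exists 1%N; last by exists 1.
  by rewrite ?dvdn1 ?neq_ltn ?prime_gt1 ?orbT.
- move=> x y /pintP[d pd [a xE]] /pintP[e pe [b yE]]; apply/pintP.
  exists (d * e)%N; first by rewrite Euclid_dvdM // negb_or pd.
  exists (a * e%:Z - b * d%:Z).
  by rewrite natrM rmorphB !rmorphM /= -xE -yE; ring.
- move=> x y /pintP[d pd [a xE]] /pintP[e pe [b yE]]; apply/pintP.
  exists (d * e)%N; first by rewrite Euclid_dvdM // negb_or pd.
  by exists (a * b); rewrite natrM rmorphM /= -xE -yE; ring.
Qed.
HB.instance Definition _ := GRing.isSubringClosed.Build rat Zloc pint_subring.

Definition punit x := [&& x != 0, x \in Zloc & x^-1 \in Zloc].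

Lemma punit_pint x : punit x -> x \in Zloc. Proof. by case/and3P. Qed.
Lemma punitV_pint x : punit x -> x^-1 \in Zloc. Proof. by case/and3P. Qed.
Lemma punit_neq0 x : punit x -> x != 0. Proof. by case/and3P. Qed.
Hint Resolve punit_pint punitV_pint punit_neq0 : core.

Lemma punit_int (a : int) : ~~ (p %| `|a|)%N -> punit a%:~R.
Proof.
move=> pa; have a0 : a != 0 by apply: contraNneq pa => ->; rewrite dvdn0.
rewrite /punit intr_eq0 a0 rpred_int /=; apply/pintP.
exists `|a|%N => //; exists (Num.sg a).
rewrite natr_absz normrEsg rmorphM /= mulrCA mulVf ?mulr1 //.
by rewrite intr_eq0.
Qed.

Lemma punit_nat n : ~~ (p %| n)%N -> punit n%:R.
Proof. by move=> pn; rewrite pmulrn; exact: punit_int. Qed.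

Lemma punitM x y : punit x -> punit y -> punit (x * y).
Proof.
move=> /and3P[x0 px pvx] /and3P[y0 py pvy].
by rewrite /punit mulf_neq0 // rpredM // invfM rpredM.
Qed.

Lemma punitV x : punit x -> punit x^-1.
Proof. by case/and3P=> x0 px pvx; rewrite /punit invr_eq0 invrK x0 px pvx. Qed.

(** * Congruences modulo powers of p between rationals *)

Definition cg k x y := (x - y) / p%:R ^+ k \in Zloc.

Lemma pexp_neq0 k : p%:R ^+ k != 0 :> rat.
Proof. by rewrite expf_neq0 // pnatr_eq0 -lt0n prime_gt0. Qed.
Hint Resolve pexp_neq0 : core.

Lemma cgP k x y : reflect (exists2 z, z \in Zloc & x = y + p%:R ^+ k * z)
  (cg k x y).
Proof.
apply: (iffP idP) => [zP|[z zP ->]].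
  by exists ((x - y) / p%:R ^+ k) => //; rewrite mulrC divfK // subrKC.
by rewrite /cg addrAC subrr add0r mulrAC divff ?mul1r ?pexp_neq0.
Qed.

Lemma cg_refl k x : cg k x x.
Proof. by rewrite /cg subrr mul0r rpred0. Qed.
Hint Resolve cg_refl : core.

Lemma cg_sym k x y : cg k x y -> cg k y x.
Proof. by rewrite /cg -(opprB x) mulNr rpredN. Qed.

Lemma cg_trans k y x z : cg k x y -> cg k y z -> cg k x z.
Proof.
move=> xy yz; rewrite /cg -(subrK y x) -addrA mulrDl.
exact: rpredD.
Qed.

Lemma cgD k x x' y y' : cg k x x' -> cg k y y' -> cg k (x + y) (x' + y').
Proof. by move=> xx yy; rewrite /cg opprD addrACA mulrDl rpredD. Qed.

Lemma cgN k x y : cg k x y -> cg k (- x) (- y).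
Proof. by move=> xy; rewrite /cg -opprD mulNr rpredN. Qed.

Lemma cgM k x x' y y' : x \in Zloc -> y' \in Zloc ->
  cg k x x' -> cg k y y' -> cg k (x * y) (x' * y').
Proof.
move=> px py xx yy.
have E : (x * y - x' * y') / p%:R ^+ k =
   x * ((y - y') / p%:R ^+ k) + (x - x') / p%:R ^+ k * y' by ring.
by rewrite /cg E rpredD // rpredM.
Qed.

Lemma cg_pint k x y : cg k x y -> y \in Zloc -> x \in Zloc.
Proof.
by move=> /cgP[z zP ->] py; rewrite rpredD // rpredM // rpredX // rpred_nat.
Qed.

Lemma cgMl k x y y' : x \in Zloc -> cg k y y' -> cg k (x * y) (x * y').
Proof. by move=> px yy; rewrite /cg -mulrBr -mulrA rpredM. Qed.

Lemma cgX k n x y : x \in Zloc -> y \in Zloc ->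
  cg k x y -> cg k (x ^+ n) (y ^+ n).
Proof.
by move=> px py xy; elim: n => // n IH; rewrite !exprS cgM // rpredX.
Qed.

Lemma cg_sum k (f g : nat -> rat) m n :
  (forall i, (m <= i < n)%N -> cg k (f i) (g i)) ->
  cg k (\sum_(m <= i < n) f i) (\sum_(m <= i < n) g i).
Proof.
move=> fg; rewrite !big_nat; elim/big_rec2: _ => // i x y /fg.
exact: cgD.
Qed.

Lemma cg_prod k n (f g : 'I_n -> rat) :
  (forall i, f i \in Zloc) -> (forall i, cg k (f i) (g i)) ->
  cg k (\prod_(i < n) f i) (\prod_(i < n) g i).
Proof.
move=> pf fg; pose K x y := (x \in Zloc) && cg k x y.
suff: K (\prod_(i < n) f i) (\prod_(i < n) g i) by case/andP.
elim/big_rec2: _ => [|i x y _ /andP[py yx]]; first by rewrite /K rpred1 cg_refl.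
rewrite /K rpredM //= cgM //; apply: cg_pint (cg_sym yx) py.
Qed.

Lemma cg_le j k x y : (j <= k)%N -> cg k x y -> cg j x y.
Proof.
move=> jk /cgP[z zP ->]; apply/cgP; exists (p%:R ^+ (k - j) * z).
  by rewrite rpredM // rpredX // rpred_nat.
by rewrite mulrA -exprD subnKC.
Qed.

Lemma cg_scale k x y : cg k x y -> cg k.+1 (p%:R * x) (p%:R * y).
Proof.
move=> /cgP[z zP ->]; apply/cgP; exists z => //.
by rewrite exprS; ring.
Qed.

Lemma cgV k x y : punit x -> punit y -> cg k x y -> cg k x^-1 y^-1.
Proof.
move=> ux uy xy; have x0 := punit_neq0 ux; have y0 := punit_neq0 uy.
have E : (x^-1 - y^-1) / p%:R ^+ k = - ((x - y) / p%:R ^+ k * x^-1 * y^-1).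
  by field; rewrite x0 y0 pexp_neq0.
rewrite /cg E rpredN; apply: rpredM (punitV_pint uy).
by apply: rpredM (punitV_pint ux).
Qed.

(** Write $x = y + pz$ and $z/y = a/d$ with $p \nmid d$. Then $x = y(d+pa)/d$, and $p \nmid d +
    pa$. *)
Lemma punit_cg x y : cg 1 x y -> punit y -> punit x.
Proof.
move=> xy uy; have y0 := punit_neq0 uy.
have /cgP[z zP xE] := xy.
have /pintP[d pd [a E]] : z / y \in Zloc by rewrite rpredM ?punitV_pint.
have d0 : d%:R != 0 :> rat by rewrite pnatr_eq0; apply: contraNneq pd => ->.
have u : punit (d%:Z + p%:Z * a)%:~R.
  apply: punit_int; apply: contra pd => pu.
  have : (p%:Z %| d%:Z + p%:Z * a - p%:Z * a)%Z.
    by rewrite rpredB // dvdz_mulr.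
  by rewrite addrK.
have -> : x = y * (d%:Z + p%:Z * a)%:~R / d%:R.
  by rewrite rmorphD rmorphM /= -E xE expr1 -!pmulrn; field; rewrite y0 d0.
by rewrite punitM ?punitM // punitV // punit_nat.
Qed.

(** * Passage from p-integral rationals to $\mathbb{Z}_p$ *)

Lemma pres_natr n k : (n%:R : 'Zp[p_pr]) k = (n %% p ^ k)%N.
Proof.
elim: n => [|n IH]; first by [].
by rewrite mulrS /= IH modnDm add1n.
Qed.

Lemma padic_natr_unit n : ~~ (p %| n)%N -> (n%:R : 'Zp[p_pr]) \is a GRing.unit.
Proof. by move=> pn; rewrite qualifE /= /padic_unit pres_natr expn1. Qed.

(** Inverses of nonunits of ['Zp[p_pr]] are default values, so [ratr] respects the ring operations
    only on p-integral rationals. There any denominator prime to p determines its value. *)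
Lemma ratr_padicE x (d : nat) (a : int) : ~~ (p %| d)%N ->
  x * d%:R = a%:~R -> ratr x * d%:R = a%:~R :> 'Zp[p_pr].
Proof.
move=> pd E.
have px : x \in Zloc by apply/pintP; exists d => //; exists a.
have u : ((denq x)%:~R : 'Zp[p_pr]) \is a GRing.unit.
  by rewrite -[denq x]gtr0_norm ?denq_gt0 // -abszE -pmulrn padic_natr_unit.
apply: (mulIr u); rewrite /ratr mulrAC divrK //.
have E2 : numq x * d%:Z = a * denq x.
  apply: (@intr_inj rat); rewrite !rmorphM /= -E mulrAC; congr (_ * _).
  by rewrite -{2}(divq_num_den x) divfK // intr_eq0 denq_neq0.
by rewrite pmulrn -!intrM E2.
Qed.

Lemma ratr_padicD x y : x \in Zloc -> y \in Zloc ->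
  ratr (x + y) = ratr x + ratr y :> 'Zp[p_pr].
Proof.
move=> /pintP[d pd [a xE]] /pintP[e pe [b yE]].
have pde : ~~ (p %| d * e)%N by rewrite Euclid_dvdM // negb_or pd.
apply: (mulIr (padic_natr_unit pde)).
rewrite (@ratr_padicE _ _ (a * e%:Z + b * d%:Z)) //; last first.
  by rewrite natrM rmorphD !rmorphM /= -xE -yE; ring.
rewrite natrM rmorphD !rmorphM /= -(ratr_padicE pd xE) -(ratr_padicE pe yE).
by rewrite -!pmulrn; ring.
Qed.

Lemma ratr_padicM x y : x \in Zloc -> y \in Zloc ->
  ratr (x * y) = ratr x * ratr y :> 'Zp[p_pr].
Proof.
move=> /pintP[d pd [a xE]] /pintP[e pe [b yE]].
have pde : ~~ (p %| d * e)%N by rewrite Euclid_dvdM // negb_or pd.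
apply: (mulIr (padic_natr_unit pde)).
rewrite (@ratr_padicE _ _ (a * b)) //; last first.
  by rewrite natrM rmorphM /= -xE -yE; ring.
rewrite natrM rmorphM /= -(ratr_padicE pd xE) -(ratr_padicE pe yE).
by ring.
Qed.

Lemma ratr_padicX x n : x \in Zloc -> ratr (x ^+ n) = ratr x ^+ n :> 'Zp[p_pr].
Proof.
move=> px; elim: n => [|n IH]; first exact: ratr_nat 1.
by rewrite !exprS ratr_padicM ?rpredX // IH.
Qed.

Lemma ratr_padic_sum m n (f : nat -> rat) :
    (forall i, (m <= i < n)%N -> f i \in Zloc) ->
  ratr (\sum_(m <= i < n) f i) = \sum_(m <= i < n) ratr (f i) :> 'Zp[p_pr].
Proof.
move=> pf; rewrite !big_nat.
pose K x (z : 'Zp[p_pr]) := x \in Zloc /\ ratr x = z.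
suff: K (\sum_(m <= i < n | (m <= i < n)%N) f i)
  (\sum_(m <= i < n | (m <= i < n)%N) ratr (f i)) by case.
elim/big_rec2: _ => [|i x y /pf fi [yP <-]].
  by split; [exact: rpred0 | exact: (ratr_nat _ 0)].
by split; [rewrite rpredD | rewrite ratr_padicD].
Qed.

Lemma cg_padic k x y : y \in Zloc -> cg k x y ->
  congr_mod (p%:R ^+ k : 'Zp[p_pr]) (ratr x) (ratr y).
Proof.
move=> py /cgP[z zP ->]; exists (ratr z).
rewrite ratr_padicD ?rpredM ?rpredX ?rpred_nat // addrAC subrr add0r.
by rewrite ratr_padicM ?rpredX ?rpred_nat // ratr_padicX ?rpred_nat // ratr_nat.
Qed.

End Local.

(** * The p-adic Gamma function *)

Section Gamma.
Variables (p : nat) (p_pr : prime p).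
Local Notation Zloc := (pint p_pr).

Definition pfact n := \prod_(1 <= j < n | ~~ (p %| j)%N) j.

Lemma pfactS n : pfact n.+1 = (pfact n * (if (p %| n)%N then 1 else n))%N.
Proof.
case: n => [|n]; first by rewrite /pfact dvdn0 !big_geq.
rewrite /pfact (big_cat_nat (n := n.+1)) //=; congr (_ * _)%N.
by rewrite big_mkcond big_nat1; case: (p %| _)%N.
Qed.

(** The product runs over integers below $ip+b+1$: full blocks $jp+1, \dots, jp+p-1$ for $j < i$,
    then the first [b] entries of block [i]. The omitted multiples of p separate the blocks. *)
Lemma pfact_block i b : (b < p)%N ->
  (pfact (i * p + b.+1))%:R =
  (\prod_(j < i) poch (j * p + 1)%:R p.-1) * poch (i * p + 1)%:R b :> rat.
Proof.
elim: i b => [|i IHi] b.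
  rewrite big_ord0 mul1r mul0n !add0n.
  elim: b => [|b IHb] bp; first by rewrite /pfact big_geq // poch0.
  rewrite pfactS pochS -IHb; last exact: ltnW.
  rewrite ifF ?natrM; last by rewrite gtnNdvd.
  by rewrite nat1r.
have p0 := prime_gt0 p_pr.
elim: b => [|b IHb] bp.
  rewrite addn1 pfactS dvdn_mull // muln1 poch0 mulr1.
  by rewrite big_ord_recr /= -IHi prednK // mulSn addnC.
rewrite addnS pfactS pochS mulrA -IHb; last exact: ltnW.
rewrite dvdn_addr ?dvdn_mull // gtnNdvd // natrM.
by congr (_ * _); rewrite -natrD; congr (_%:R); rewrite -addnA add1n.
Qed.

Lemma poch_pint x n : x \in Zloc -> poch x n \in Zloc.
Proof. by move=> px; apply: rpred_prod => i _; rewrite rpredD // rpred_nat. Qed.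

Lemma cg_poch k n x y : x \in Zloc -> cg p_pr k x y ->
  cg p_pr k (poch x n) (poch y n).
Proof.
move=> px xy; apply: cg_prod => i; first by rewrite rpredD // rpred_nat.
by apply: cgD => //; exact: cg_refl.
Qed.

Lemma cg_dvd k m n : (m = n %[mod p ^ k])%N -> cg p_pr k m%:R n%:R.
Proof.
wlog mn : m n / (n <= m)%N => [W E|].
  by have [|/ltnW] := leqP n m => h; [|apply: cg_sym]; apply: W.
move/eqP; rewrite eqn_mod_dvd // => /dvdnP[q E]; apply/cgP; exists q%:R.
  exact: rpred_nat.
by rewrite -natrX -natrM -natrD mulnC -E subnKC.
Qed.

Lemma cg_wilson : cg p_pr 1 (p.-1)`!%:R (-1).
Proof.
have : (p %| ((p.-1)`!).+1)%N by rewrite -Wilson ?prime_gt1.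
move=> /dvdnP[q E]; apply/cgP; exists q%:R; first exact: rpred_nat.
by rewrite expr1 -natrM mulnC -E -natr1; ring.
Qed.

Lemma dvdn_cg n : cg p_pr 1 n%:R 0 -> (p %| n)%N.
Proof.
move=> /cgP[z /pintP[d pd [a E]]].
rewrite expr1 add0r => /(congr1 ( *%R^~ d%:R)); rewrite -mulrA E => H.
have /(congr1 absz) : n%:Z * d%:Z = p%:Z * a.
  by apply: (@intr_inj rat); rewrite !rmorphM /= -!pmulrn.
rewrite !abszM /= => {}H.
by rewrite -(Gauss_dvdl _ (p := d)) ?H ?dvdn_mulr // prime_coprime.
Qed.

(* Inversion permutes the units. *)
Lemma prod_units_sqr q : (1 < q)%N ->
  ((\prod_(0 <= j < q | coprime q j) j)%:R : 'Z_q) ^+ 2 = 1.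
Proof.
move=> q1.
have -> : (\prod_(0 <= j < q | coprime q j) j =
    \prod_(0 <= j < (Zp_trunc q).+2 | coprime q j) j)%N by rewrite Zp_cast.
rewrite big_mkord natr_prod.
have -> : \prod_(i < (Zp_trunc q).+2 | coprime q i) i%:R =
    \prod_(x : 'Z_q | x \is a GRing.unit) x :> 'Z_q.
  apply: eq_big => [i|i _]; last exact: natr_Zp.
  by rewrite -[X in _ = (X \is a _)]natr_Zp unitZpE.
rewrite expr2 {2}(reindex_inj (@invr_inj _)) /=.
under [X in _ * X]eq_bigl do rewrite unitrV.
rewrite -big_split /= big1 // => x ux; exact: divrr.
Qed.

Hypothesis p_odd : odd p.

(** The product $W$ satisfies $W^2 \equiv 1 \pmod{p^k}$ and $W \equiv -1 \pmod p$. As p is odd it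
    does not divide $W-1$, so all of $p^k$ divides $W+1$. *)
Lemma pfact_wilson k : (0 < k)%N -> cg p_pr k (pfact (p ^ k))%:R (-1).
Proof.
case: k => // k _; set W := pfact _.
have p1 := prime_gt1 p_pr; have p0 := prime_gt0 p_pr.
have pk0 : (0 < p ^ k)%N by rewrite expn_gt0 p0.
have q1 : (1 < p ^ k.+1)%N by rewrite -(exp1n k.+1) ltn_exp2r.
have W1 : (p %| W.+1)%N.
  apply: dvdn_cg; rewrite -[0](addNr 1) -natr1.
  apply: cgD; last exact: cg_refl.
  have -> : W = pfact ((p ^ k).-1 * p + p.-1.+1).
    by rewrite /W prednK // -mulSnr prednK // expnSr.
  (* There are $p^k$ blocks, an odd number, and each is $-1$ modulo p by Wilson; the last one is the
     trailing block of [pfact_block]. *)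
  have -> : -1 = (\prod_(j < (p ^ k).-1) -1) * -1 :> rat.
    rewrite prodr_const card_ord -exprSr prednK //.
    by rewrite -signr_odd oddX p_odd orbT.
  have E i : cg p_pr 1 (poch (i * p + 1)%:R p.-1) (-1).
    apply: cg_trans cg_wilson; rewrite -poch1; apply: cg_poch.
      exact: rpred_nat.
    by apply: (cg_dvd (n := 1)); rewrite expn1 modnMDl.
  rewrite pfact_block ?prednK //; apply: cgM => //.
  - by apply: rpred_prod => i _; rewrite poch_pint ?rpred_nat.
  - by rewrite rpredN1.
  - by apply: cg_prod => i //; rewrite poch_pint ?rpred_nat.
have W0 : (0 < W)%N.
  by rewrite lt0n; apply: contraTneq W1 => ->; rewrite dvdn1 neq_ltn p1 orbT.
have WM : (p ^ k.+1 %| W.+1 * W.-1)%N.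
  have := prod_units_sqr q1.
  have -> : (\prod_(0 <= j < p ^ k.+1 | coprime (p ^ k.+1) j) j)%N = W.
    rewrite big_ltn_cond ?(ltnW q1) // {1}/coprime gcdn0 ifF; last first.
      by apply/negbTE; rewrite neq_ltn q1 orbT.
    apply: eq_bigl => j.
    by rewrite coprime_pexpl ?prime_coprime.
  move=> E0; have := natrX 'Z_(p ^ k.+1) W 2; rewrite {}E0.
  move=> /(congr1 val); rewrite /= !val_Zp_nat // => /eqP.
  rewrite -[X in _ == X](modn_small q1).
  rewrite eqn_mod_dvd ?expn_gt0 ?W0 // -{2}(exp1n 2) subn_sqr.
  by rewrite addn1 subn1 mulnC.
have E : (p ^ k.+1 %| W.+1)%N.
  rewrite -(Gauss_dvdl _ (p := W.-1)) // coprimeXl // prime_coprime //.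
  apply/negP => W2; have : (p %| W.+1 - W.-1)%N by rewrite dvdn_sub.
  have -> : (W.+1 - W.-1 = 2)%N by lia.
  by move/(@dvdn_leq _ 2 isT) => p2; have := p_odd; have -> : p = 2 by lia.
have /dvdnP[t Et] := E; apply/cgP; exists t%:R; first exact: rpred_nat.
by rewrite -natrX -natrM mulnC -Et -natr1; ring.
Qed.

(** Wilson's theorem is the case $a = 0$. Each further factor changes by $p^k$, which alters neither
    its residue nor whether p divides it. *)
Lemma pfact_shift k a : (0 < k)%N ->
  cg p_pr k (pfact (a + p ^ k))%:R (- (pfact a)%:R).
Proof.
move=> k0; elim: a => [|a IH].
  by rewrite add0n /pfact [X in - X%:R]big_geq //; exact: pfact_wilson.
rewrite addSn !pfactS !natrM -mulNr; apply: cgM => //; try exact: rpred_nat.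
rewrite dvdn_addl; last by rewrite dvdn_exp.
case: ifP => _; first exact: cg_refl.
by apply: cg_dvd; rewrite modnDr.
Qed.

Definition gamma_rat n : rat := (-1) ^+ n * (pfact n)%:R.

Lemma gamma_rat_pint n : gamma_rat n \in Zloc.
Proof. by rewrite rpredMsign rpred_nat. Qed.

(** The sign $-1$ of [pfact_shift] cancels against $(-1)^{p^k} = -1$. This periodicity is the
    uniform continuity behind the p-adic limit. *)
Lemma gamma_rat_cg k a b : (a = b %[mod p ^ k])%N ->
  cg p_pr k (gamma_rat a) (gamma_rat b).
Proof.
case: k => [_|k].
  by rewrite /cg expr0 divr1 rpredB ?gamma_rat_pint.
have step c t : cg p_pr k.+1 (gamma_rat (c + t * p ^ k.+1)) (gamma_rat c).
  elim: t => [|t IH]; first by rewrite addn0; exact: cg_refl.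
  apply: cg_trans IH; rewrite mulSnr addnA.
  move: (c + _)%N => {}c; rewrite /gamma_rat exprD.
  have -> : (-1) ^+ (p ^ k.+1) = -1 :> rat.
    by rewrite -signr_odd oddX p_odd orbT.
  rewrite mulrN1 mulNr -mulrN; apply: cgMl; first by rewrite rpredX ?rpredN1.
  by rewrite -[X in cg _ _ _ X]opprK; apply: cgN; exact: pfact_shift.
have red c : cg p_pr k.+1 (gamma_rat c) (gamma_rat (c %% p ^ k.+1)).
  by rewrite {1}(divn_eq c (p ^ k.+1)) addnC.
by move=> E; apply: cg_trans (red a) _; rewrite E; exact: cg_sym.
Qed.

Lemma ratr_padic_sign n x : x \in Zloc ->
  ratr ((-1) ^+ n * x) = (-1) ^+ n * ratr x :> 'Zp[p_pr].
Proof.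
have N1 : ratr (-1) = -1 :> 'Zp[p_pr] by rewrite -[-1]/((-1)%:~R) ratr_int.
move=> px; rewrite ratr_padicM ?rpredX ?rpredN1 //.
by rewrite ratr_padicX ?rpredN1 // N1.
Qed.

Lemma gamma_natE n : padic_gamma_nat p_pr n = ratr (gamma_rat n).
Proof. by rewrite /gamma_rat ratr_padic_sign ?rpred_nat // ratr_nat. Qed.

(** * The limit defining the p-adic Gamma function *)

Lemma congr_mod_sym (m x y : 'Zp[p_pr]) : congr_mod m x y -> congr_mod m y x.
Proof. by case=> c E; exists (- c); rewrite mulrN -E opprB. Qed.

Lemma pres_pmul n (c : 'Zp[p_pr]) : (p%:R ^+ n * c) n = 0%N.
Proof. by rewrite -natrX /= pres_natr modnn mul0n mod0n. Qed.

(** If $z = x - y$ has residue 0 modulo $p^n$, its quotient by $p^n$ has residue $z_{n+m}/p^n$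
    modulo $p^m$; coherence of [z] makes these residues coherent. *)
Lemma congr_modP n (x y : 'Zp[p_pr]) : congr_mod (p%:R ^+ n) x y <-> x n = y n.
Proof.
split=> [[c E]|E].
  rewrite -[x](subrK y) E.
  have -> : pres (p%:R ^+ n * c + y) n =
      ((pres (p%:R ^+ n * c)%R n + y n) %% p ^ n)%N by [].
  by rewrite pres_pmul add0n presK.
have p0 := prime_gt0 p_pr.
set z := x - y.
have z0 : z n = 0%N.
  have -> : z n = ((x n + (p ^ n - y n) %% p ^ n) %% p ^ n)%N by [].
  rewrite modnDmr E subnKC ?modnn //.
  by rewrite -presK ltnW // ltn_pmod // expn_gt0 p0.
have zmod m : (z (n + m) %% p ^ n = 0)%N.
  elim: m => [|m IH]; first by rewrite addn0 z0 mod0n.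
  rewrite addnS -[RHS]IH [z (n + m)%N]presP modn_dvdm //.
  by rewrite expnD dvdn_mulr.
have pn0 : (0 < p ^ n)%N by rewrite expn_gt0 p0.
have cP m : (z (n + m) %/ p ^ n = (z (n + m.+1) %/ p ^ n) %% p ^ m)%N.
  rewrite addnS [z (n + m)%N]presP.
  have /dvdnP[t ->] : (p ^ n %| z (n + m).+1)%N by rewrite /dvdn -addnS zmod.
  by rewrite mulnK // expnD [(p ^ n * _)%N]mulnC -muln_modl mulnK.
exists (PadicInt p_pr cP); apply: padic_eqP => m.
rewrite -natrX.
have -> : ((p ^ n)%:R * PadicInt p_pr cP : 'Zp[p_pr]) m =
   (((p ^ n)%:R : 'Zp[p_pr]) m * (z (n + m) %/ p ^ n) %% p ^ m)%N by [].
rewrite pres_natr modnMml mulnC divnK; last by rewrite /dvdn zmod.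
elim: n {z0 pn0 cP E zmod} => [|n IH]; first by rewrite add0n presK.
by rewrite addSn IH [z (n + m)%N]presP modn_dvdm // expnD dvdn_mull.
Qed.

(** Adding $p^n$ keeps the residue and makes the integer positive, as the sequences in [padic_gamma]
    must be. *)
Definition padic_approx (x : 'Zp[p_pr]) n := (x n + p ^ n)%N.

Lemma padic_approx_gt0 x n : (0 < padic_approx x n)%N.
Proof. by rewrite addn_gt0 expn_gt0 (prime_gt0 p_pr) orbT. Qed.

Lemma padic_approxP x n : congr_mod (p%:R ^+ n) (padic_approx x n)%:R x.
Proof. by apply/congr_modP; rewrite pres_natr modnDr presK. Qed.

Lemma gamma_nat_congr n a b : congr_mod (p%:R ^+ n : 'Zp[p_pr]) a%:R b%:R ->
  congr_mod (p%:R ^+ n) (padic_gamma_nat p_pr a) (padic_gamma_nat p_pr b).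
Proof.
move=> /congr_modP; rewrite !pres_natr !gamma_natE => E.
by apply: cg_padic; [exact: gamma_rat_pint | exact: gamma_rat_cg].
Qed.

Lemma padic_cvgP (f : nat -> 'Zp[p_pr]) x :
  f i @[i --> \oo] --> x <->
  forall n, \forall i \near \oo, congr_mod (p%:R ^+ n) (f i) x.
Proof.
split=> [fx n|fx A [n nA]].
  by apply: (fx [set y | congr_mod (p%:R ^+ n) y x]); exists n.
by apply: filterS (fx n) => i /nA.
Qed.

(** The limit is built residue by residue: modulo $p^n$ it is the value at the n-th approximation of
    [x], and periodicity gives both coherence and convergence. *)
Lemma gamma_limit_exists (x : 'Zp[p_pr]) :
  exists y : 'Zp[p_pr], forall u : nat -> nat, (forall i, 0 < u i)%N ->
    (u i)%:R @[i --> \oo] --> x ->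
    padic_gamma_nat p_pr (u i) @[i --> \oo] --> y.
Proof.
pose g n := padic_gamma_nat p_pr (padic_approx x n).
have gP n : (g n n = g n.+1 n.+1 %[mod p ^ n])%N.
  rewrite presK -presP; apply/congr_modP; apply: gamma_nat_congr.
  apply: congr_mod_trans (padic_approxP _ _) _; apply: congr_mod_sym.
  by apply: congr_mod_exp (padic_approxP _ _).
exists (mkpadic p_pr gP) => u _ /padic_cvgP ux; apply/padic_cvgP => n.
apply: filterS (ux n) => i ui.
apply: (@congr_mod_trans _ _ _ _ (g n)).
  apply: gamma_nat_congr; apply: congr_mod_trans ui _.
  exact/congr_mod_sym/padic_approxP.
by apply/congr_modP; exact/esym/presK.
Qed.

Lemma padic_gamma_congr n a (x : 'Zp[p_pr]) : x != 0 ->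
  congr_mod (p%:R ^+ n) a%:R x ->
  congr_mod (p%:R ^+ n) (padic_gamma_nat p_pr a) (padic_gamma x).
Proof.
move=> /negPf x0 ax; rewrite /padic_gamma x0.
set L := [set y | _]; have : L (get L).
  by apply: getPex; exact: gamma_limit_exists.
move: (get L) => y Ly.
have ux : (padic_approx x i)%:R @[i --> \oo] --> x.
  apply/padic_cvgP => m; exists m => // i /= mi.
  exact: congr_mod_exp mi (padic_approxP x i).
have /padic_cvgP/(_ n) [M _ HM] := Ly _ (padic_approx_gt0 x) ux.
(* The index is large enough both for the values to agree with the limit modulo $p^n$ and for the
   approximation to agree with [x]. *)
apply: congr_mod_trans (HM (maxn M n) (leq_maxl _ _)).
apply: gamma_nat_congr; apply: congr_mod_trans ax _; apply: congr_mod_sym.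
exact: congr_mod_exp (leq_maxr _ _) (padic_approxP _ _).
Qed.
End Gamma.

(** * Reduction modulo p^3 and the value at 3/4 *)

Lemma gbinom_half k :
  gbinom (- (1 / 2) : rat) k = (-1) ^+ k * poch 2^-1 k / k`!%:R.
Proof.
rewrite /gbinom; congr (_ / _).
transitivity (\prod_(i < k) - (2^-1 + i%:R : rat)); last first.
  by rewrite prodrN card_ord.
by apply: eq_bigr => i _; field.
Qed.

Lemma hsqfact0 k : hsqfact (0 : rat) k = poch 2^-1 k ^+ 2.
Proof.
by rewrite /poch -prodrXl; apply: eq_bigr => i _; rewrite subr0 addrC.
Qed.

Lemma sqfact0 k : sqfact (0 : rat) k = k`!%:R ^+ 2.
Proof.
rewrite -poch1 /poch -prodrXl; apply: eq_bigr => i _.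
by rewrite subr0 nat1r.
Qed.

(** * The truncated sum modulo $p^3$ *)

Section Trunc.
Variables (p : nat) (p_pr : prime p) (n : nat).
Hypothesis pE : p = (2 * n + 1)%N.
Local Notation Zloc := (pint p_pr).
(* [x = p^2/4], see [quarterE] *)
Local Notation x := ((n%:R + 2^-1) ^+ 2 : rat).

Lemma punit2 : punit p_pr 2.
Proof.
apply: punit_nat; apply/negP => /(@dvdn_leq _ 2 isT).
by have := prime_gt1 p_pr; lia.
Qed.

Lemma quarterE : x = p%:R ^+ 2 * (2^-1) ^+ 2.
Proof. by rewrite pE natrD natrM; field. Qed.

Lemma half_pint : 2^-1 \in Zloc. Proof. exact: punitV_pint punit2. Qed.
Hint Resolve half_pint : core.

Lemma quarter_pint : x \in Zloc.
Proof. by rewrite rpredX // rpredD // rpred_nat. Qed.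
Hint Resolve quarter_pint : core.

Lemma quarter_cg : cg p_pr 2 x 0.
Proof.
by apply/cgP; exists ((2^-1) ^+ 2); rewrite ?rpredX // add0r quarterE.
Qed.

(** Multiplied by 4, this compares an even square with an odd one. *)
Lemma sqr_subx_neq0 i : i.+1%:R ^+ 2 - x != 0.
Proof.
have -> : i.+1%:R ^+ 2 - x = ((2 * i.+1)%:R ^+ 2 - (2 * n + 1)%:R ^+ 2) / 4.
  by rewrite natrD !natrM; field.
rewrite mulf_neq0 // subr_eq0 -!natrX eqr_nat eqn_exp2r //.
by apply/eqP; lia.
Qed.

Lemma sqr_addx_neq0 i : i.+1%:R ^+ 2 - - x != 0.
Proof. by rewrite opprK lt0r_neq0 // ltr_pwDl ?sqr_ge0 // exprn_gt0. Qed.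

Lemma fact_punit k : (k < p)%N -> punit p_pr k`!%:R.
Proof.
elim: k => [|k IH] kp.
  by apply: punit_nat; rewrite dvdn1 neq_ltn prime_gt1 ?orbT.
rewrite factS natrM; apply: punitM (IH (ltnW kp)).
by apply: punit_nat; rewrite gtnNdvd.
Qed.

Lemma half_lt_p : (n < p)%N. Proof. by rewrite pE addn1 ltnS leq_pmull. Qed.

Lemma sqfact_punit y k : cg p_pr 1 y 0 -> (k <= n)%N -> punit p_pr (sqfact y k).
Proof.
move=> y0; elim: k => [|k IH] kn.
  by rewrite /sqfact big_ord0; exact: (fact_punit (k := 0) (prime_gt0 p_pr)).
rewrite sqfactS; apply: punitM (IH (ltnW kn)) _.
have kp : ~~ (p %| k.+1)%N by rewrite gtnNdvd // (leq_ltn_trans kn half_lt_p).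
apply: (@punit_cg _ _ _ (k.+1%:R ^+ 2)); last first.
  by rewrite expr2; apply: punitM; exact: punit_nat.
rewrite -[X in cg _ _ _ X]subr0; apply: cgD (cg_refl _ _ _) (cgN y0).
Qed.

Lemma sqfact_cg k y z j : y \in Zloc -> z \in Zloc -> cg p_pr k y z ->
  cg p_pr k (sqfact y j) (sqfact z j).
Proof.
move=> py pz yz; apply: cg_prod => i.
  by rewrite rpredB // rpredX // rpred_nat.
by apply: cgD (cg_refl _ _ _) (cgN yz).
Qed.

Lemma quarter_cg1 : cg p_pr 1 x 0. Proof. exact: cg_le quarter_cg. Qed.
Lemma opp_quarter_cg1 : cg p_pr 1 (- x) 0.
Proof. by rewrite -[X in cg _ _ _ X]oppr0; exact: cgN quarter_cg1. Qed.

Lemma hsqfact_pint y k : y \in Zloc -> hsqfact y k \in Zloc.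
Proof.
move=> py; apply: rpred_prod => i _.
by rewrite rpredB // rpredX // rpredD ?rpred_nat.
Qed.

Lemma ratio_cg k : (k <= n)%N ->
  cg p_pr 3 ((hsqfact x k / sqfact x k) * (hsqfact (- x) k / sqfact (- x) k))
            ((poch 2^-1 k / k`!%:R) ^+ 4).
Proof.
move=> kn.
have -> : (poch 2^-1 k / k`!%:R) ^+ 4 =
   (hsqfact 0 k * hsqfact 0 k) * (sqfact 0 k * sqfact 0 k)^-1 :> rat.
  by rewrite hsqfact0 sqfact0 exprMn exprVn -!exprD.
rewrite mulf_div.
have xx3 a : cg p_pr 3 ((a - x) * (a - - x)) ((a - 0) * (a - 0)).
  have -> : (a - x) * (a - - x) = (a - 0) * (a - 0) - x ^+ 2 by ring.
  rewrite -[X in cg _ _ _ X]subr0; apply: cgD (cg_refl _ _ _) (cgN _).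
  (* $x^2 = p^4/16 = p^3 \cdot p/16$. *)
  apply/cgP; exists (p%:R * 2^-1 ^+ 4).
    by rewrite rpredM ?rpredX ?rpred_nat.
  by rewrite quarterE; ring.
have u0 : punit p_pr (sqfact 0 k) by apply: sqfact_punit => //; exact: cg_refl.
have u1 := sqfact_punit quarter_cg1 kn.
have u2 := sqfact_punit opp_quarter_cg1 kn.
apply: cgM.
- by rewrite rpredM ?hsqfact_pint ?rpredN.
- by apply: punitV_pint; exact: punitM.
- rewrite /hsqfact -!big_split; apply: cg_prod => i /=; last exact: xx3.
  by rewrite rpredM // rpredB ?rpredN // rpredX // rpredD ?rpred_nat.
- apply: cgV; [exact: punitM | exact: punitM | ].
  rewrite /sqfact -!big_split; apply: cg_prod => i /=; last exact: xx3.
  by rewrite rpredM // rpredB ?rpredN // rpredX ?rpred_nat.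
Qed.

Lemma poch_half_pint k : (poch 2^-1 k : rat) \in Zloc.
Proof. exact: poch_pint. Qed.

Lemma legendre_term_pint k : (k <= n)%N -> legendre_term rat n k \in Zloc.
Proof.
move=> kn; have u := fact_punit (leq_ltn_trans kn half_lt_p).
rewrite /legendre_term rpredM //.
  by rewrite rpredM ?poch_half_pint ?hsqfact_pint.
by apply: punitV_pint; rewrite !punitM.
Qed.

Lemma sum_cg_legendre :
  cg p_pr 3 (\sum_(0 <= k < n.+1)
      (4 * k + 1)%:R * gbinom (- (1 / 2) : rat) k ^+ 5)
    ((-1) ^+ n * (p%:R * legendre_sum rat n)).
Proof.
apply: (@cg_trans _ _ _ (\sum_(0 <= k < n.+1) (4 * k + 1)%:R * wcoef x k *
   (hsqfact (- x) k / sqfact (- x) k))).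
  apply: cg_sum => k; rewrite /= ltnS => kn.
  have u := fact_punit (leq_ltn_trans kn half_lt_p).
  have -> : (4 * k + 1)%:R * gbinom (- (1 / 2) : rat) k ^+ 5 =
    ((4 * k + 1)%:R * ((-1) ^+ k * poch 2^-1 k / k`!%:R)) *
    (poch 2^-1 k / k`!%:R) ^+ 4.
    rewrite gbinom_half -mulrA; move: (poch _ _ / _) => q.
    have s4 : (-1) ^+ k ^+ 4 = 1 :> rat.
      by rewrite (exprM _ 2 2) sqrr_sign expr1n.
    by transitivity ((4 * k + 1)%:R * ((-1) ^+ k ^+ 4 * ((-1) ^+ k * q ^+ 5)));
      [ring | rewrite s4; ring].
  have -> : (4 * k + 1)%:R * wcoef x k * (hsqfact (- x) k / sqfact (- x) k) =
    ((4 * k + 1)%:R * ((-1) ^+ k * poch 2^-1 k / k`!%:R)) *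
    ((hsqfact x k / sqfact x k) * (hsqfact (- x) k / sqfact (- x) k)).
    by rewrite /wcoef; ring.
  apply: cgMl; last exact/cg_sym/ratio_cg.
  rewrite rpredM ?rpred_nat // rpredM ?punitV_pint // rpredM ?poch_half_pint //.
  by rewrite rpredX ?rpredN1.
rewrite (whipple erefl sqr_subx_neq0 sqr_addx_neq0) -mulrA -pE.
apply: cgMl; first by rewrite rpredX ?rpredN1.
apply: cg_scale; apply: cg_sum => j; rewrite /= ltnS => jn.
have u := fact_punit (leq_ltn_trans jn half_lt_p).
have u2 := sqfact_punit opp_quarter_cg1 jn.
rewrite /legendre_term; apply: cgMl.
  by rewrite rpredM ?poch_half_pint ?hsqfact_pint.
apply: cgV; [exact: punitM | by rewrite !punitM | ].
apply: cgMl; first exact: rpred_nat.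
rewrite -sqfact0; apply: sqfact_cg; [by rewrite rpredN | exact: rpred0 | ].
by rewrite -[X in cg _ _ _ X]oppr0; apply: cgN quarter_cg.
Qed.
End Trunc.

(** * The value at 3/4 modulo $p^2$ *)

Section Quarter.
Variables (p : nat) (p_pr : prime p) (m : nat).
Hypothesis pE : p = (4 * m + 1)%N.
Local Notation Zloc := (pint p_pr).

Let pE2 : p = (2 * (2 * m) + 1)%N. Proof. by rewrite pE; lia. Qed.
Let B : rat := (p.-1)`!%:R.
Let p_odd : odd p. Proof. by rewrite pE oddD oddM. Qed.

Lemma cg_sqr k (a b : rat) : punit p_pr (a + b) ->
  cg p_pr k (a ^+ 2) (b ^+ 2) -> cg p_pr k a b.
Proof.
move=> u ab; have u0 := punit_neq0 u.
have E : (a - b) / p%:R ^+ k = (a ^+ 2 - b ^+ 2) / p%:R ^+ k * (a + b)^-1.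
  by rewrite subr_sqr -!mulrA [X in _ = _ * X]mulrCA;
    field; rewrite u0 pexp_neq0.
by rewrite /cg E; apply: rpredM (punitV_pint u).
Qed.

Lemma poch_add (a : rat) i j : poch a (i + j) = poch a i * poch (a + i%:R) j.
Proof.
elim: j => [|j IH]; first by rewrite addn0 poch0 mulr1.
by rewrite addnS !pochS IH -mulrA natrD addrA.
Qed.

(* Pairing the factors [ip+r] and [ip+p-r] gives the congruence of the
   squares. *)
Lemma poch_fact_cg i : cg p_pr 2 (poch (i * p + 1)%:R p.-1) B.
Proof.
set Q := poch _ _.
have QP : Q \in Zloc by rewrite poch_pint ?rpred_nat.
have BP : B \in Zloc by exact: rpred_nat.
have QB : cg p_pr 1 Q B.
  rewrite /Q /B -poch1; apply: cg_poch; first exact: rpred_nat.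
  by apply: (@cg_dvd _ _ _ _ 1); rewrite expn1 modnMDl.
have uB : punit p_pr B by apply: fact_punit; rewrite prednK ?prime_gt0.
(* $Q + B \equiv 2B \pmod p$ is a unit, which excludes the root $Q \equiv -B$. *)
have uQB : punit p_pr (Q + B).
  apply: (@punit_cg _ _ _ (B * 2)); last by apply: punitM; [|exact: punit2 pE2].
  by rewrite mulr_natr mulr2n; apply: cgD QB (cg_refl _ _ _).
apply: cg_sqr uQB _; rewrite /B -poch1 /Q /poch !expr2.
rewrite {2}(reindex_inj rev_ord_inj).
rewrite [X in cg _ _ _ (_ * X)](reindex_inj rev_ord_inj) /=.
rewrite -!big_split /=; apply: cg_prod => r.
  by rewrite rpredM ?rpredD ?rpred_nat.
(* $(ip+r)(ip+p-r) = r(p-r) + p^2 i(i+1)$. *)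
apply/cgP; exists (i%:R * (1 + i%:R)).
  by rewrite rpredM ?rpredD ?rpred1 ?rpred_nat.
have e : p.-1%:R = p%:R - 1 :> rat by rewrite -subn1 natrB ?prime_gt0.
rewrite natrB // e -[r.+1%:R]natr1.
by rewrite !(natrD, natrM); ring.
Qed.

Lemma pfact_cg i b : (b < p)%N ->
  cg p_pr 2 (pfact p (i * p + b.+1))%:R (B ^+ i * poch (i * p + 1)%:R b).
Proof.
move=> bp; rewrite pfact_block //.
have -> : B ^+ i = \prod_(j < i) B by rewrite prodr_const card_ord.
apply: cgM.
- by apply: rpred_prod => j _; rewrite poch_pint ?rpred_nat.
- by rewrite poch_pint ?rpred_nat.
- by apply: cg_prod => j; [rewrite poch_pint ?rpred_nat | exact: poch_fact_cg].
- exact: cg_refl.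
Qed.

(** The product below $p^2$ consists of p blocks, each congruent to [B], and is $-1$ by Wilson
    modulo $p^2$. *)
Lemma factX_cg : cg p_pr 2 (B ^+ p) (-1).
Proof.
have p0 := prime_gt0 p_pr.
apply: cg_trans (pfact_wilson p_pr p_odd (k := 2) isT); apply: cg_sym.
have -> : (p ^ 2 = p.-1 * p + p.-1.+1)%N.
  by rewrite prednK // -mulSnr prednK // mulnn.
have -> : B ^+ p = B ^+ p.-1 * B by rewrite -exprSr prednK.
rewrite pfact_block ?prednK //.
have -> : B ^+ p.-1 = \prod_(j < p.-1) B by rewrite prodr_const card_ord.
apply: cgM; try exact: poch_fact_cg.
- by apply: rpred_prod => j _; rewrite poch_pint ?rpred_nat.
- exact: rpred_nat.
- by apply: cg_prod => j; [rewrite poch_pint ?rpred_nat | exact: poch_fact_cg].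
Qed.

Let h : rat := 2^-1.
Let half_pintP : h \in Zloc. Proof. exact: half_pint pE2. Qed.

(** Since $2m = (p-1)/2$, the two starting points differ by $p^2/2$. *)
Lemma poch_neg2m b :
  cg p_pr 2 (poch (2 * m * p + 1)%:R b) (poch (h - (2 * m)%:R) b).
Proof.
apply: cg_poch; first exact: rpred_nat.
apply/cgP; exists h; first exact: half_pintP.
by rewrite pE !(natrD, natrM) /h; field.
Qed.

(** Block $2m$ is congruent to the product of $1/2-2m, \dots, 2m-1/2$. This list is symmetric about
    0, with $2m$ negative entries, so its product is $(1/2)_{2m}^2$. *)
Lemma poch_half_sqr : cg p_pr 2 (poch h (2 * m) ^+ 2) B.
Proof.
apply: cg_trans (poch_fact_cg (2 * m)); apply: cg_sym.
have -> : p.-1 = (2 * m + 2 * m)%N by rewrite pE; lia.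
apply: cg_trans (poch_neg2m _) _.
rewrite poch_add subrK.
have := poch_rev h (2 * m).
have -> : 1 - h - (2 * m)%:R = h - (2 * m)%:R by rewrite /h; field.
by move=> ->; rewrite exprM sqrrN !expr1n mul1r expr2 cg_refl.
Qed.

(** The Gamma value is $\pm B^m P_1$, and $P_1^2 \equiv P_0P_2$ with $P_0 = m!$ cancels the
    denominator of $L_{2m}$. What is left is $B^{4m}(P_2\,(1/2)_m)^2 \equiv B^{4m}B = B^p \equiv
    -1$. *)
Lemma gamma_quarter_cg :
  cg p_pr 2 (legendre_sum rat (2 * m) * gamma_rat p (m * p + m.+1) ^+ 4) (-1).
Proof.
have mp : (m < p)%N by rewrite pE; lia.
have fm := fact_punit p_pr mp.
set P0 := poch 1 m : rat; set P1 := poch (m * p + 1)%:R m : rat.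
set P2 := poch (2 * m * p + 1)%:R m : rat.
have P0P : P0 \in Zloc by rewrite poch_pint ?rpred1.
have P1P : P1 \in Zloc by rewrite poch_pint ?rpred_nat.
have P2P : P2 \in Zloc by rewrite poch_pint ?rpred_nat.
have BP : B \in Zloc by exact: rpred_nat.
have hpP k : poch h k \in Zloc by exact: poch_pint.
have sq : cg p_pr 2 (P1 ^+ 2) (P0 * P2).
  rewrite /P0 /P1 /P2 /poch -prodrXl -big_split /=; apply: cg_prod => i.
    by rewrite rpredX // rpredD ?rpred_nat.
  (* $(mp+r)^2 = r(2mp+r) + m^2p^2$. *)
  apply/cgP; exists (m%:R ^+ 2); first by rewrite rpredX ?rpred_nat.
  by rewrite !(natrD, natrM); ring.
have g4 : gamma_rat p (m * p + m.+1) ^+ 4 = (pfact p (m * p + m.+1))%:R ^+ 4.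
  rewrite /gamma_rat exprMn -exprM mulnC exprM.
  by rewrite (exprM _ 2 2) sqrr_sign !expr1n mul1r.
have := pfact_cg m mp; rewrite -/P1; move: (pfact p _)%:R g4 => W g4 WP.
have WZ : W \in Zloc by apply: cg_pint WP _; rewrite rpredM ?rpredX.
have uV : m`!%:R^-1 \in Zloc by exact: punitV_pint fm.
have LP : legendre_sum rat (2 * m) = poch h m ^+ 2 * m`!%:R^-1 ^+ 2.
  by rewrite mul2n legendre_sum_even exprMn.
have f0 := punit_neq0 fm.
rewrite g4 LP.
apply: (@cg_trans _ _ _ (poch h m ^+ 2 * m`!%:R^-1 ^+ 2 * (B ^+ m * P1) ^+ 4)).
  apply: cgMl; first by rewrite rpredM ?rpredX.
  by apply: cgX => //; rewrite rpredM ?rpredX.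
apply: (@cg_trans _ _ _
    (poch h m ^+ 2 * m`!%:R^-1 ^+ 2 * B ^+ (4 * m) * (P0 * P2) ^+ 2)).
  have -> : (B ^+ m * P1) ^+ 4 = B ^+ (4 * m) * (P1 ^+ 2) ^+ 2.
    by rewrite exprMn -!exprM mulnC.
  rewrite mulrA; apply: cgMl; first by rewrite rpredM ?rpredX // rpredM ?rpredX.
  by apply: cgX => //; rewrite ?rpredX ?rpredM.
have -> : poch h m ^+ 2 * m`!%:R^-1 ^+ 2 * B ^+ (4 * m) * (P0 * P2) ^+ 2 =
  B ^+ (4 * m) * (P2 * poch h m) ^+ 2.
  by rewrite /P0 poch1; field.
apply: cg_trans factX_cg.
have -> : B ^+ p = B ^+ (4 * m) * B by rewrite -exprSr pE addn1.
apply: cgMl; first by rewrite rpredX.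
apply: cg_trans poch_half_sqr.
(* Reversed, $(1/2)_{2m}$ starts at $1/2-2m$. Its first half is congruent to $P_2$, and its second
   half is $(1/2)_m$ reversed, up to sign. *)
have e : poch h (2 * m) ^+ 2 = (poch (h - (2 * m)%:R) m * poch h m) ^+ 2.
  have := poch_rev h (2 * m).
  have -> : 1 - h - (2 * m)%:R = h - (2 * m)%:R by rewrite /h; field.
  rewrite exprM sqrrN !expr1n mul1r => <-.
  rewrite mul2n -addnn poch_add natrD exprMn [RHS]exprMn; congr (_ * _).
  have -> : h - (m%:R + m%:R) + m%:R = 1 - h - m%:R by rewrite /h; field.
  by rewrite poch_rev exprMn sqrr_sign mul1r.
rewrite e; apply: cgX.
- by rewrite rpredM.
- by rewrite rpredM // poch_pint // rpredB ?rpred_nat.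
apply: cgM => //; last exact: cg_refl.
by rewrite /P2; exact: poch_neg2m.
Qed.
End Quarter.

(** * Assembly in $\mathbb{Z}_p$ *)

Section Final.
Variables (p : nat) (p_pr : prime p).
Local Notation Zp := 'Zp[p_pr].

Lemma congr_modM (q x x' y y' : Zp) :
  congr_mod q x x' -> congr_mod q y y' -> congr_mod q (x * y) (x' * y').
Proof.
move=> [c xE] [d yE]; exists (x * d + c * y').
by rewrite mulrDr mulrCA -yE mulrA -xE; ring.
Qed.

Lemma congr_modX (q x y : Zp) n :
  congr_mod q x y -> congr_mod q (x ^+ n) (y ^+ n).
Proof.
move=> xy; elim: n => [|n IH]; first exact: congr_mod_refl.
by rewrite !exprS; exact: congr_modM.
Qed.

Lemma unitr_congr_mod (x y : Zp) : congr_mod (p%:R ^+ 1) x y ->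
  y \is a GRing.unit -> x \is a GRing.unit.
Proof.
move=> /congr_modP E.
by change (is_true (y 1%N != 0%N) -> is_true (x 1%N != 0%N)); rewrite E.
Qed.

Lemma sum_padic n : p = (2 * n + 1)%N ->
  congr_mod (p%:R ^+ 3 : Zp)
    (\sum_(0 <= k < n.+1)
      (4 * k + 1)%:R * ratr (gbinom (- (1 / 2) : rat) k) ^+ 5)
    ((-1) ^+ n * (p%:R * ratr (legendre_sum rat n))).
Proof.
move=> pE.
have gP k : (k < n.+1)%N -> gbinom (- (1 / 2) : rat) k \in pint p_pr.
  rewrite ltnS gbinom_half => kn.
  have u := fact_punit p_pr (leq_ltn_trans kn (half_lt_p pE)).
  apply: rpredM (punitV_pint u).
  by rewrite rpredM ?(poch_half_pint p_pr pE) // rpredX ?rpredN1.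
have LP : legendre_sum rat n \in pint p_pr.
  rewrite /legendre_sum big_nat rpred_sum // => j /andP[_ jn].
  exact: legendre_term_pint.
have pLP : p%:R * legendre_sum rat n \in pint p_pr by rewrite rpredM ?rpred_nat.
have RP : (-1) ^+ n * (p%:R * legendre_sum rat n) \in pint p_pr.
  by rewrite rpredMsign.
have := cg_padic RP (sum_cg_legendre p_pr pE).
rewrite ratr_padic_sign // ratr_padicM ?rpred_nat // ratr_nat.
rewrite ratr_padic_sum; last first.
  by move=> k /andP[_ kn]; rewrite rpredM ?rpred_nat ?rpredX ?gP.
have -> : \sum_(0 <= k < n.+1)
      ratr ((4 * k + 1)%:R * gbinom (- (1 / 2) : rat) k ^+ 5) =
    \sum_(0 <= k < n.+1)
      (4 * k + 1)%:R * ratr (gbinom (- (1 / 2) : rat) k) ^+ 5 :> Zp.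
  rewrite !big_nat; apply: eq_bigr => k /andP[_ kn].
  by rewrite ratr_padicM ?rpred_nat ?rpredX ?gP // ratr_padicX ?gP // ratr_nat.
by [].
Qed.
End Final.

Theorem theorem1p2 (p : nat) (p_pr : prime p) (p_odd : odd p) :
  let S : 'Zp[p_pr] :=
    \sum_(0 <= k < ((p - 1) %/ 2).+1)
      (4 * k + 1)%:R * ratr (gbinom (- (1 / 2) : rat) k) ^+ 5 in
  ((p = 1 %[mod 4])%N ->
    congr_mod (p%:R ^+ 3) S
      (- (p%:R / padic_gamma (3 / 4 : 'Zp[p_pr]) ^+ 4))) /\
  ((p = 3 %[mod 4])%N -> congr_mod (p%:R ^+ 3) S 0).
Proof.
set n := ((p - 1) %/ 2)%N => S.
have pE : p = (2 * n + 1)%N by rewrite /n; lia.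
have SL := sum_padic p_pr pE; rewrite -/S in SL.
split=> pmod; last first.
  have nE : n = (n %/ 2).*2.+1 by lia.
  have -> : 0 = (-1) ^+ n * (p%:R * ratr (legendre_sum rat n)) :> 'Zp[p_pr].
    by rewrite {2}nE legendre_sum_odd (ratr_nat _ 0) !mulr0.
  exact: SL.
set m := (p %/ 4)%N.
have pE4 : p = (4 * m + 1)%N by rewrite /m; lia.
have nE : n = (2 * m)%N by lia.
have u4 : (4 : 'Zp[p_pr]) \is a GRing.unit.
  apply: padic_natr_unit; rewrite (Euclid_dvdX 2 2 p_pr) andbT.
  apply/negP => /(@dvdn_leq _ 2 isT).
  by have := prime_gt1 p_pr; lia.
(* Otherwise p divides 3, whereas $p \equiv 1 \pmod 4$ forces $p \ge 5$. *)
have x0 : 3 / 4 != 0 :> 'Zp[p_pr].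
  apply/eqP => /(congr1 ( *%R^~ 4)); rewrite divrK // mul0r.
  move=> /(congr1 (fun z : 'Zp[p_pr] => z 1%N)); rewrite pres_natr.
  rewrite /= mod0n expn1 => /eqP /(@dvdn_leq _ 3 isT).
  by have := prime_gt1 p_pr; lia.
(* $4(mp+m+1) - 3 = p^2$, so the quotient is 1/4. *)
have NE : congr_mod (p%:R ^+ 2) (m * p + m.+1)%:R (3 / 4 : 'Zp[p_pr]).
  exists (4^-1); apply: (mulIr u4); rewrite mulrBl divrK //.
  rewrite -mulrA mulVr // mulr1.
  apply/eqP; rewrite subr_eq -natrX -natrM -natrD.
  by apply/eqP; congr (_%:R); rewrite {1 2}pE4; ring.
have := padic_gamma_congr p_odd x0 NE; rewrite gamma_natE.
set g := gamma_rat _ _; set G := padic_gamma _ => gG.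
set L := legendre_sum rat n in SL.
have LP : L \in pint p_pr.
  rewrite /L /legendre_sum big_nat rpred_sum // => j /andP[_ jn].
  exact: legendre_term_pint.
have gP : g \in pint p_pr by exact: gamma_rat_pint.
have Lg : congr_mod (p%:R ^+ 2 : 'Zp[p_pr]) (ratr L * ratr g ^+ 4) (-1).
  have := cg_padic (rpredN1 _) (gamma_quarter_cg p_pr pE4).
  rewrite -nE -/L -/g ratr_padicM ?rpredX // ratr_padicX //.
  have -> : ratr (-1) = -1 :> 'Zp[p_pr] by rewrite -[-1]/((-1)%:~R) ratr_int.
  by [].
have LG : congr_mod (p%:R ^+ 2 : 'Zp[p_pr]) (ratr L * G ^+ 4) (-1).
  apply: congr_mod_trans Lg; apply: congr_modM; first exact: congr_mod_refl.
  exact: congr_modX (congr_mod_sym gG).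
(* A factor of something congruent to $-1$ is a unit, so the division in the statement is a genuine
   one. *)
have uG : G ^+ 4 \is a GRing.unit.
  have : ratr L * G ^+ 4 \is a GRing.unit.
    by apply: unitr_congr_mod (congr_mod_exp _ LG) _; rewrite ?unitrN1.
  by rewrite unitrM => /andP[].
apply: congr_mod_trans SL _; rewrite nE exprM sqrrN !expr1n mul1r.
(* Dividing $LG^4 + 1 = p^2c$ by $G^4$ and multiplying by p gives the congruence modulo $p^3$. *)
case: LG => c LG; exists (c / G ^+ 4).
rewrite opprK -mulrDr (exprS _ 2) -[RHS]mulrA; congr (_ * _).
apply: (mulIr uG); rewrite mulrDl mulVr // -[RHS]mulrA divrK // -LG.
by rewrite opprK.
Qed.
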